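(* Let $n$ be a positive integer and let $S=S_1\cup S_2\subseteq T_{8n}\setminus\{e\}$, where $S_1=(\langle a^2\rangle\setminus\{e\})\cup\langle a\rangle b^2$ and $S_2=\langle a\rangle b\cup\langle a\rangle b^3$ (so that $S=S^{-1}$). Then $\mathrm{Cay}(T_{8n},S)$ is a connected integral graph, whose spectrum is $$\mathrm{Spec}(\mathrm{Cay}(T_{8n},S))=\left\{[7n-1],\,[-n-1]^3,\,[n-1]^4,\,[-1]^{8(n-1)}\right\}.$$
   Context: $T_{8n}=\langle a,b\mid a^{2n}=b^8=e,\ a^n=b^4,\ b^{-1}ab=a^{-1}\rangle$ is a group of order $8n$ with elements $a^rb^s$, $0\le r\le 2n-1$, $0\le s\le 3$. For a finite group $G$ with identity $e$ and a nonempty $S\subseteq G\setminus\{e\}$ with $S=S^{-1}$, $\mathrm{Cay}(G,S)$ is the graph with vertex set $G$ in which $x,y$ are adjacent iff $xy^{-1}\in S$. A graph is integral if all eigenvalues of its adjacency matrix are integers. $\mathrm{Spec}$ is the multiset of adjacency eigenvalues; $[\lambda]^m$ means $\lambda$ occurs with multiplicity $m$ ($m$ omitted if $m=1$). *)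

(* Defs.v *)
From HB Require Import structures.
From mathcomp Require Import all_boot all_order all_fingroup all_algebra.
From mathcomp Require Import all_solvable all_field.

Set Implicit Arguments.
Unset Strict Implicit.
Unset Printing Implicit Defensive.

Import Order.TTheory GRing.Theory Num.Theory.

Local Open Scope group_scope.

(* [T8n_gens n a b] says that the whole group of [gT] is T_{8n} and that [a],
   [b] are the two generators of its presentation.  The clause [\isog Grp]
   fixes [gT] up to isomorphism.  The other clauses fix [a] and [b]: the
   morphism sending the abstract generators to [a] and [b] is a surjective
   endomorphism of a finite group, hence an automorphism. *)
Definition T8n_gens (n : nat) (gT : finGroupType) (a b : gT) : Prop :=
  [/\ [set: gT] \isog
        Grp (x : y : x ^+ (2 * n) = 1, y ^+ 8 = 1, x ^+ n = y ^+ 4,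
                     x ^ y = x^-1),
      <<[set a; b]>> = [set: gT]
    & [/\ a ^+ (2 * n) = 1, b ^+ 8 = 1, a ^+ n = b ^+ 4 & a ^ b = a^-1]].

Definition T8n_S1 (gT : finGroupType) (a b : gT) : {set gT} :=
  (<[a ^+ 2]> :\ 1) :|: (<[a]> :* b ^+ 2).

Definition T8n_S2 (gT : finGroupType) (a b : gT) : {set gT} :=
  (<[a]> :* b) :|: (<[a]> :* b ^+ 3).

Definition T8n_S (gT : finGroupType) (a b : gT) : {set gT} :=
  T8n_S1 a b :|: T8n_S2 a b.

(* The condition under which Cay(G, S) is a simple undirected graph; S^-1 is
   the pointwise inverse of S. *)
Definition connection_set (gT : finGroupType) (S : {set gT}) : Prop :=
  [/\ S != set0, 1 \notin S & S^-1 = S].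

Definition cayley (gT : finGroupType) (S : {set gT}) : rel gT :=
  fun x y => x * y^-1 \in S.

Local Open Scope ring_scope.

Definition adjacency_mx (T : finType) (e : rel T) : 'M[algC]_#|T| :=
  \matrix_(i, j) (e (enum_val i) (enum_val j))%:R.

Definition connected_graph (T : finType) (e : rel T) : Prop :=
  forall x y : T, connect e x y.

Definition integral_graph (T : finType) (e : rel T) : Prop :=
  forall z : algC, eigenvalue (adjacency_mx e) z -> z \is a Num.int.

(* The eigenvalues of A with multiplicity, i.e. the roots of its
   characteristic polynomial.  Their order in the list is unspecified:
   multisets are compared with perm_eq. *)
Definition Spec (m : nat) (A : 'M[algC]_m) : seq algC :=
  sval (closed_field_poly_normal (char_poly A)).

(* Main.v *)
(* Put N = <a> and H = <a^2>, of orders 2n and n.  Then S is the disjoint union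
   of the complement of N and of H minus the identity.  Writing e_K for the
   averaging operator over the cosets of a subgroup K, the adjacency matrix is
   therefore 8n e_G - 2n e_N + n e_H - e_1.  As 1 <= H <= N <= G is a chain, the
   differences of consecutive e_K are orthogonal idempotents with sum 1, so the
   adjacency matrix is diagonalised by them, and the multiplicities are the
   differences of the traces tr e_K = |G : K|.  That a and b do not satisfy more
   relations than expected is seen on the right regular representation of
   T_{8n}, written down on pairs (r, s) standing for a^r b^s. *)
Require Import Defs.
From mathcomp Require Import all_boot all_order all_fingroup all_algebra.
From mathcomp Require Import all_solvable all_field ring.

Set Implicit Arguments.
Unset Strict Implicit.
Unset Printing Implicit Defensive.

Import Order.TTheory GRing.Theory Num.Theory.
Local Open Scope ring_scope.

(** * Characteristic polynomials of combinations of orthogonal idempotents *)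

(** Multiplying [M] by one unitriangular block matrix, on the right and on the left, exhibits each
    side as the determinant of [M]. *)
Lemma det_1D_mulmxC (R : comNzRingType) (m r : nat)
    (C : 'M[R]_(m, r)) (D : 'M[R]_(r, m)) :
  \det (1%:M + C *m D) = \det (1%:M + D *m C).
Proof.
pose M := block_mx 1%:M (- C) D 1%:M.
have ML :
    M *m block_mx 1%:M 0 (- D) 1%:M = block_mx (1%:M + C *m D) (- C) 0 1%:M.
  rewrite mulmx_block !mulmx1 !mul1mx !mulmx0 mulmxN mulNmx opprK.
  by rewrite subrr !add0r.
have MR :
    block_mx 1%:M 0 (- D) 1%:M *m M = block_mx 1%:M (- C) 0 (1%:M + D *m C).
  rewrite mulmx_block !mulmx1 !mul1mx !mul0mx !addr0 mulmxN mulNmx opprK.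
  by rewrite addNr addrC.
have := congr1 determinant ML; have := congr1 determinant MR.
by rewrite !det_mulmx !det_lblock !det_ublock !det1 !mul1r !mulr1 => -> <-.
Qed.

(** With [P = C *m R] the rank factorisation, cancel the outer [C] and [R] in
    [C *m R *m C *m R = C *m R]. *)
Lemma mul_row_col_base_idem (F : fieldType) (m : nat) (P : 'M[F]_m) :
  P *m P = P -> row_base P *m col_base P = 1%:M.
Proof.
move=> idP; have cfree := col_base_full P; have rfree := row_base_free P.
apply: (row_free_inj rfree); rewrite mul1mx; apply: (row_full_inj cfree).
by rewrite -(mulmxA (row_base P)) mulmx_base mulmxA mulmx_base.
Qed.

Lemma mxtrace_idem (F : fieldType) (m : nat) (P : 'M[F]_m) :
  P *m P = P -> \tr P = (\rank P)%:R.
Proof.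
move/mul_row_col_base_idem=> RC.
by rewrite -{1}(mulmx_base P) mxtrace_mulC RC mxtrace1.
Qed.

Lemma det_1D_idem (F : fieldType) (m : nat) (P : 'M[F]_m) (c : {poly F}) :
  P *m P = P -> \det (1%:M + c *: map_mx polyC P) = (1 + c) ^+ \rank P.
Proof.
move/mul_row_col_base_idem=> RC.
rewrite -{1}(mulmx_base P) map_mxM scalemxAl det_1D_mulmxC -scalemxAr.
by rewrite -map_mxM RC map_mx1 -[X in X + _]scale1r -scalerDl detZ det1 mulr1.
Qed.

(** As the [P i] sum to 1, the characteristic matrix is [1 + \sum_i c i *: Q i]; orthogonality
    factors it into the matrices [1 + c i *: Q i]. *)
Lemma char_poly_orthogonal_idem (F : fieldType) (m k : nat)
    (P : 'I_k -> 'M[F]_m) (z : 'I_k -> F) :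
  (forall i j, P i *m P j = if i == j then P i else 0) ->
  \sum_i P i = 1%:M ->
  char_poly (\sum_i z i *: P i) = \prod_i ('X - (z i)%:P) ^+ \rank (P i).
Proof.
move=> orthP sumP; pose Q i := map_mx polyC (P i).
pose c i : {poly F} := 'X - (z i)%:P - 1.
have cE i : 1 + c i = 'X - (z i)%:P by rewrite addrC subrK.
have orthQ i j : Q i *m Q j = if i == j then Q i else 0.
  by rewrite -map_mxM orthP; case: eqP => _ //; rewrite map_mx0.
have -> : char_poly (\sum_i z i *: P i) = \det (1%:M + \sum_i c i *: Q i).
  rewrite /char_poly /char_poly_mx; congr (\det _).
  have sumQ : \sum_i Q i = 1%:M by rewrite -map_mx_sum sumP map_mx1.
  rewrite -['X%:M]scalemx1 -sumQ scaler_sumr map_mx_sum -sumrB -big_split.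
  apply: eq_bigr => i _.
  by rewrite /= map_mxZ -scalerBl -[X in _ = X + _]scale1r -scalerDl cE.
have det_sum s : uniq s ->
    \det (1%:M + \sum_(i <- s) c i *: Q i) =
    \prod_(i <- s) (1 + c i) ^+ \rank (P i).
  elim: s => [|i s IHs] /=; first by rewrite !big_nil addr0 det1.
  case/andP=> sNi /IHs {}IHs; rewrite !big_cons -IHs.
  rewrite -det_1D_idem; last by rewrite orthP eqxx.
  rewrite -det_mulmx mulmxDl mul1mx mulmxDr mulmx1; congr (\det _).
  rewrite mulmx_sumr [\sum_(_ <- _) _ *m _]big1_seq ?addr0 => [|j /andP[_ sj]].
    by rewrite addrA addrAC.
  rewrite -scalemxAl -scalemxAr orthQ; case: eqP sNi => [->|_ _].
    by rewrite sj.
  by rewrite !scaler0.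
rewrite det_sum ?index_enum_uniq //; apply: eq_bigr => i _.
by rewrite cE.
Qed.

Lemma char_poly_idem_chain (F : numFieldType) (m k : nat)
    (e : nat -> 'M[F]_m) (d : nat -> nat) (z : nat -> F) :
  (forall i j, e i *m e j = e (maxn i j)) -> e 0%N = 1%:M -> e k = 0 ->
  (forall i, \tr (e i) = (d i)%:R) ->
  char_poly (\sum_(i < k) z i *: (e i - e i.+1)) =
    \prod_(i < k) ('X - (z i)%:P) ^+ (d i - d i.+1).
Proof.
move=> eM e0 ek trE.
have orthE i j :
    (e i - e i.+1) *m (e j - e j.+1) = if i == j then e i - e i.+1 else 0.
  rewrite mulmxBl !mulmxBr !eM; case: ltngtP => [ltij|ltji|<-].
  - rewrite (maxn_idPr (leqW (ltnW ltij))).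
    by rewrite (maxn_idPr ltij) maxnSS (maxn_idPr (ltnW ltij)) subrr.
  - rewrite (maxn_idPl (leqW (ltnW ltji))).
    by rewrite (maxn_idPl ltji) maxnSS (maxn_idPl (ltnW ltji)) !subrr.
  - by rewrite !maxnn (maxn_idPr (leqnSn i)) (maxn_idPl (leqnSn i)) subrr subr0.
rewrite (@char_poly_orthogonal_idem _ _ _ (fun i => e (val i) - e (val i).+1)
  (fun i => z (val i))) => [|i j|]; first last.
- rewrite -(big_mkord xpredT (fun i => e i - e i.+1)).
  rewrite (eq_bigr (fun i => - (e i.+1 - e i))) => [|i _]; last first.
    by rewrite opprB.
  by rewrite sumrN telescope_sumr // e0 ek opprB subr0.
- by rewrite orthE val_eqE.
apply: eq_bigr => i _; congr (_ ^+ _).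
(* In characteristic 0 the trace determines the rank: [d i] is the rank plus [d i.+1], so the
   truncated subtraction is exact. *)
have := mxtrace_idem (P := e i - e i.+1); rewrite orthE eqxx => /(_ erefl).
rewrite raddfB /= !trE => /eqP; rewrite subr_eq -natrD eqr_nat => /eqP ->.
by rewrite addnK.
Qed.

(** * Averaging operators of subgroups *)

(** For a subgroup [K], [cayley K] relates the elements of each right coset, loops included, so this
    matrix projects onto the functions constant on these cosets. *)
Definition avg_mx (gT : finGroupType) (K : {set gT}) : 'M[algC]_#|gT| :=
  #|K|%:R^-1 *: adjacency_mx (cayley K).

Section AvgMx.
Variables (gT : finGroupType).
Implicit Types K L : {group gT}.
Local Notation adjK K := (adjacency_mx (cayley (K : {set gT}))).

Lemma avg_mxE K : adjK K = #|K|%:R *: avg_mx K.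
Proof. by rewrite scalerA mulfV ?scale1r // pnatr_eq0 -lt0n cardG_gt0. Qed.

Lemma trmx_avg_mx K : (avg_mx K)^T = avg_mx K.
Proof.
apply/matrixP => i j; rewrite !mxE; congr (_ * (nat_of_bool _)%:R).
by rewrite /cayley -groupV invMg invgK.
Qed.

Lemma avg_mx_mulr K L : K \subset L -> avg_mx K *m avg_mx L = avg_mx L.
Proof.
move=> sKL; rewrite /avg_mx -scalemxAl -scalemxAr scalerA.
suff -> : adjK K *m adjK L = #|K|%:R *: adjK L.
  by rewrite scalerA mulrAC mulVf ?mul1r // pnatr_eq0 -lt0n cardG_gt0.
apply/matrixP => i j; rewrite !mxE; set x := enum_val i; set y := enum_val j.
rewrite (reindex (@enum_rank gT)) /=; last exact: onW_bij (enum_rank_bij _).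
(* Only [t] in [K :* x] contributes, and then [t] and [x] lie in the same right coset of [L]. *)
transitivity (\sum_(t : gT | t \in (K :* x)%g) (cayley L x y)%:R : algC).
  rewrite [RHS]big_mkcond /=; apply: eq_bigr => t _.
  rewrite !mxE enum_rankK -/x -/y mem_rcoset /cayley.
  rewrite -[(x * t^-1)%g]invgK groupV invMg invgK.
  case: ifP => [Ktx|_]; last by rewrite mul0r.
  rewrite mul1r -[t in (t * _)%g](mulgKV x) -mulgA groupMl //.
  exact: (subsetP sKL).
by rewrite sumr_const card_rcoset mulr_natl.
Qed.

Lemma avg_mx_mull K L : K \subset L -> avg_mx L *m avg_mx K = avg_mx L.
Proof.
move=> sKL; apply: trmx_inj.
by rewrite trmx_mul !trmx_avg_mx avg_mx_mulr.
Qed.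

Lemma avg_mx1 : avg_mx (1%g : {set gT}) = 1%:M.
Proof.
apply/matrixP => i j; rewrite !mxE cards1 invr1 mul1r /cayley inE.
by rewrite -eq_mulgV1 (inj_eq enum_val_inj).
Qed.

Lemma mxtrace_avg_mx K : \tr (avg_mx K) = #|[set: gT] : K|%g%:R.
Proof.
rewrite /mxtrace (eq_bigr (fun=> #|K|%:R^-1)) => [|i _].
  rewrite sumr_const card_ord -cardsT -(Lagrange (subsetT K)) -[LHS]mulr_natr.
  by rewrite natrM mulKf // pnatr_eq0 -lt0n cardG_gt0.
by rewrite !mxE /cayley mulgV group1 mulr1.
Qed.

(** Cutting [e] and [d] off to 0 at index [k] makes the last difference the operator of the last
    subgroup itself. *)
Lemma char_poly_subgroup_chain (k : nat) (K : nat -> {group gT})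
    (z : nat -> algC)
    (e := fun i => if (i < k)%N then avg_mx (K i) else 0)
    (d := fun i => if (i < k)%N then #|[set: gT] : K i|%g else 0%N) :
  (0 < k)%N -> K 0%N = 1%G -> (forall i, K i \subset K i.+1) ->
  char_poly (\sum_(i < k) z i *: (e i - e i.+1)) =
    \prod_(i < k) ('X - (z i)%:P) ^+ (d i - d i.+1).
Proof.
move=> k_gt0 K0 subK.
have homoK : {homo K : i j / (i <= j)%N >-> i \subset j}.
  apply: (homo_leq (r := fun L M : {group gT} => L \subset M)) subK.
    by move=> L; exact: subxx.
  by move=> M L P; exact: subset_trans.
apply: char_poly_idem_chain => [i j|||i]; rewrite /e ?ltnn //.
- have [le_ij|/ltnW le_ji] := leqP i j.
    case: (ltnP j k) => [lt_jk|_]; last exact: mulmx0.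
    by rewrite (leq_ltn_trans le_ij lt_jk) avg_mx_mulr ?homoK.
  case: (ltnP i k) => [lt_ik|_]; last exact: mul0mx.
  by rewrite (leq_ltn_trans le_ji lt_ik) avg_mx_mull ?homoK.
- by rewrite k_gt0 K0 avg_mx1.
by rewrite /d; case: ifP => _; rewrite ?mxtrace0 ?mxtrace_avg_mx.
Qed.
End AvgMx.

(** * The right regular representation of T_{8n} *)

Section RegularModel.
Variable n : nat.
Local Notation Z := 'Z_(2 * n).

(* b^s a = a^(reg_sign s) b^s. *)
Definition reg_sign (s : 'Z_4) : Z := (-1) ^+ s.

Definition reg_a_fun (x : Z * 'Z_4) : Z * 'Z_4 := (x.1 + reg_sign x.2, x.2).

(* a^r b^3 * b = a^(r + n), as b^4 = a^n. *)
Definition reg_b_fun (x : Z * 'Z_4) : Z * 'Z_4 :=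
  (x.1 + (if x.2 == 3%:R then n%:R else 0), x.2 + 1).

Lemma reg_a_inj : injective reg_a_fun.
Proof.
case=> r s [r' s'] /eqP/andP[/eqP + /eqP /= eqs].
by rewrite /= eqs => /addIr ->.
Qed.

Lemma reg_b_inj : injective reg_b_fun.
Proof.
case=> r s [r' s'] /eqP/andP[/eqP + /eqP /addIr /= eqs].
by rewrite /= eqs => /addIr ->.
Qed.

Definition reg_a := perm reg_a_inj.
Definition reg_b := perm reg_b_inj.

Lemma reg_signS s : reg_sign (s + 1) = - reg_sign s.
Proof.
case: s => [[|[|[|[|//]]]] lts]; rewrite /reg_sign /= ?expr0 ?expr1 ?exprS;
  by rewrite ?mulr1 ?mulrNN ?mulr1 ?opprK ?mulN1r ?opprK.
Qed.

Lemma reg_aX k x : (reg_a ^+ k)%g x = (x.1 + reg_sign x.2 *+ k, x.2).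
Proof.
case: x => r s; elim: k => [|k IHk]; first by rewrite expg0 perm1 mulr0n addr0.
by rewrite expgSr permM IHk permE /reg_a_fun /= mulrSr addrA.
Qed.

Hypothesis n_gt0 : (0 < n)%N.

(** The type ['Z_p] has modulus [p] only for [1 < p]; here [0 < n] ensures this. *)
Lemma natr2n : (2 * n)%:R = 0 :> Z.
Proof. by rewrite pchar_Zp // mul2n -addnn -[2%N]/(1 + 1)%N leq_add. Qed.

Lemma oppr_natn : - n%:R = n%:R :> Z.
Proof. by apply/eqP; rewrite eq_sym -addr_eq0 -natrD addnn -mul2n natr2n. Qed.

(** Four steps in ['Z_4] pass through 3 exactly once, so [n] is added once. *)
Lemma reg_b4 x : (reg_b ^+ 4)%g x = (x.1 + n%:R, x.2).
Proof.
rewrite !expgS expg0 mulg1 !permM !permE; case: x => r s.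
rewrite /reg_b_fun /= -!addrA; congr (_, _); last first.
  by rewrite (_ : 1 + _ = 0) ?addr0 //; apply: val_inj.
congr (_ + _).
by case: s => [[|[|[|[|//]]]] lts]; rewrite -?val_eqE /= ?addr0 ?add0r.
Qed.

Lemma reg_a_rel : (reg_a ^+ (2 * n) = 1)%g.
Proof.
by apply/permP => -[r s]; rewrite reg_aX perm1 -mulr_natr natr2n mulr0 addr0.
Qed.

Lemma reg_ab_rel : (reg_a ^+ n = reg_b ^+ 4)%g.
Proof.
apply/permP => -[r s]; rewrite reg_aX reg_b4 /=; congr (_ + _, _).
rewrite /reg_sign -signr_odd.
by case: odd; rewrite ?expr0 ?expr1 ?mulNrn ?oppr_natn.
Qed.

Lemma reg_b_rel : (reg_b ^+ 8 = 1)%g.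
Proof.
by rewrite (expgM _ 4 2) -reg_ab_rel -expgM [(n * 2)%N]mulnC reg_a_rel.
Qed.

Lemma reg_conj_rel : (reg_a ^ reg_b = reg_a^-1)%g.
Proof.
(* This form of the relation avoids computing the inverse permutation. *)
have ba : (reg_a * reg_b * reg_a = reg_b)%g.
  apply/permP => -[r s]; rewrite !permM !permE /reg_a_fun /reg_b_fun /=.
  by rewrite reg_signS; congr (_, _); rewrite addrAC addrK.
by apply: (mulIg reg_a); rewrite mulVg conjgE -mulgA ba mulVg.
Qed.

Lemma reg_transitive x :
  exists2 g, g \in (<[reg_a]> <*> <[reg_b]>)%g & g (0, 0) = x.
Proof.
(* At second coordinate [s], [reg_a] moves by [reg_sign s]; the same sign in the exponent cancels
   it. *)
case: x => r s; exists (reg_b ^+ s * reg_a ^+ (reg_sign s * r))%g.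
  by rewrite groupM // groupX // mem_gen // inE cycle_id ?orbT.
rewrite permM; have -> : (reg_b ^+ s)%g (0, 0) = (0, s).
  case: s => [[|[|[|[|//]]]] lts] /=;
    rewrite ?expgS ?expg0 ?mulg1 ?permM !permE /reg_b_fun //=;
    by congr (_, _); rewrite ?addr0 //; exact: val_inj.
rewrite reg_aX add0r -[in LHS]mulr_natr natrM !natr_Zp mulrA.
by rewrite /reg_sign -expr2 sqrr_sign mul1r.
Qed.

End RegularModel.

(** * The order of the group and the cosets making up S *)

Section Cosets.
Variables (n : nat) (gT : finGroupType) (a b : gT).
Hypotheses (n_gt0 : (0 < n)%N) (genT : T8n_gens n a b).
Local Notation N := (<[a]>)%G.

(** By the presentation the model group [H] is an image of the whole group, and it is transitive on
    8n points. *)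
Lemma T8n_card_ge : (2 * n * 4 <= #|[set: gT]|)%N.
Proof.
have [isoG _ _] := genT.
pose H := (<[reg_a n]> <*> <[reg_b n]>)%G.
have homH : (H \homg [set: gT])%g.
  rewrite isoG; apply/existsP; exists (reg_a n, reg_b n) => /=.
  rewrite !xpair_eqE reg_a_rel // reg_b_rel // reg_ab_rel // reg_conj_rel //.
  by rewrite !eqxx.
apply: leq_trans (leq_homg homH).
have gt1_2n : (1 < 2 * n)%N by rewrite mul2n -addnn -[2%N]/(1 + 1)%N leq_add.
have <- : #|[set: 'Z_(2 * n) * 'Z_4]| = (2 * n * 4)%N.
  by rewrite cardsT card_prod !card_ord !Zp_cast.
apply: leq_trans (dvdn_leq (cardG_gt0 H) (dvdn_orbit 'P H (0, 0))).
apply/subset_leq_card/subsetP => x _.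
by have [g Hg <-] := reg_transitive x; apply: mem_orbit.
Qed.

Lemma T8n_norm_b : b \in ('N(N))%g.
Proof.
have [_ _ [_ _ _ ab]] := genT.
by rewrite -cycle_subG norms_cycle ab groupV cycle_id.
Qed.

Lemma T8n_quotient : ([set: gT] / N = <[coset N b]>)%g.
Proof.
have [_ <- _] := genT; have Nb := T8n_norm_b.
rewrite -quotient_cycle // -(quotientYidl (H := N) (G := <[b]>)) ?cycle_subG //.
by rewrite joing_idl joing_idr.
Qed.

Lemma T8n_normal : [set: gT] \subset ('N(N))%g.
Proof.
have [_ <- _] := genT.
by rewrite gen_subG subUset !sub1set T8n_norm_b (subsetP (normG _)) ?cycle_id.
Qed.

Lemma T8n_indexE : #|[set: gT] : N|%g = #[coset N b]%g.
Proof. by rewrite -card_quotient ?T8n_normal // T8n_quotient. Qed.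

(** The relations bound the two orders by 2n and 4, since [b ^+ 4 = a ^+ n] lies in [N]; their
    product is at least 8n, so both bounds are attained. *)
Lemma T8n_card_eq : #[a]%g = (2 * n)%N /\ #[coset N b]%g = 4%N.
Proof.
have [_ _ [a2n _ abn _]] := genT.
have gt0_2n : (0 < 2 * n)%N by rewrite muln_gt0.
have le_oa : (#[a]%g <= 2 * n)%N by rewrite dvdn_leq // order_dvdn a2n.
have le_ob : (#[coset N b]%g <= 4)%N.
  rewrite dvdn_leq // order_dvdn -morphX ?T8n_norm_b // -abn.
  by rewrite /= coset_id ?mem_cycle.
have := T8n_card_ge; rewrite -(Lagrange (subsetT N)) T8n_indexE -orderE.
move=> ge_oab; split; apply/eqP; rewrite eqn_leq.
  rewrite le_oa -(leq_pmul2r (m := 4)) //; apply: leq_trans ge_oab _.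
  by rewrite leq_mul2l le_ob orbT.
rewrite le_ob -(leq_pmul2l gt0_2n); apply: leq_trans ge_oab _.
by rewrite leq_mul2r le_oa orbT.
Qed.

Lemma mem_T8n_S x :
  x \in T8n_S a b = (x \notin N) || (x \in <[a ^+ 2]> :\ 1)%g.
Proof.
have [_ ob] := T8n_card_eq; have Nb := T8n_norm_b.
have Nx : x \in ('N(N))%g by rewrite (subsetP T8n_normal) ?inE.
have rcosetX k : (x \in N :* b ^+ k)%g = (coset N x == coset N b ^+ k)%g.
  have Nbk : (b ^+ k)%g \in ('N(N))%g by rewrite groupX.
  rewrite mem_rcoset -morphX // eq_mulgV1 -morphV // -morphM ?groupV //.
  by apply/idP/eqP => [/coset_id|/coset_idr->//]; rewrite ?groupM ?groupV.
have N_coset : (x \in N) = (coset N x == 1)%g.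
  by rewrite -(rcosetX 0%N) expg0 rcoset1.
have /cyclePmin[i lti xE] : coset N x \in <[coset N b]>%g.
  by rewrite -T8n_quotient mem_quotient ?inE.
rewrite /T8n_S /T8n_S1 /T8n_S2 !in_setU (rcosetX 1%N) !rcosetX xE.
have eqX k : (coset N b ^+ i == coset N b ^+ k)%g = (i == k %[mod 4]).
  by rewrite eq_expg_mod_order ob.
rewrite N_coset xE -(expg0 (coset N b)) !eqX.
(* The cosets with [i] = 1, 2, 3 lie wholly in S; for [i] = 0 only the part in [<[a ^+ 2]> :\ 1]
   remains. *)
move: lti; rewrite ob.
by case: i {xE eqX} => [|[|[|[|//]]]] _; rewrite /= ?orbT ?orbF.
Qed.

Lemma T8n_notin_b : b \notin N.
Proof.
have [_ ob] := T8n_card_eq.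
by apply/negP => /coset_id cb1; move: ob; rewrite cb1 order1.
Qed.
End Cosets.

(** * The spectrum of the Cayley graph *)

Lemma Spec_eq (m : nat) (A : 'M[algC]_m) (s : seq algC) :
  char_poly A = \prod_(z <- s) ('X - z%:P) -> perm_eq (Spec A) s.
Proof.
rewrite /Spec; case: closed_field_poly_normal => r /= ->.
by rewrite (monicP (char_poly_monic A)) scale1r; apply: prod_XsubC_eq.
Qed.

Section Spectrum.
Variables (n : nat) (gT : finGroupType) (a b : gT).
Hypotheses (n_gt0 : (0 < n)%N) (genT : T8n_gens n a b).
Local Notation H := (<[a ^+ 2]>)%G.
Local Notation N := (<[a]>)%G.

Lemma T8n_sub_H_N : H \subset N.
Proof. by rewrite cycle_subG mem_cycle. Qed.

Lemma T8n_card_H : #|H| = n.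
Proof.
have [oa _] := T8n_card_eq n_gt0 genT.
by rewrite -orderE orderXdiv oa ?dvdn_mulr // mulKn.
Qed.

Lemma T8n_card_G : #|[set: gT]| = (8 * n)%N.
Proof.
have [oa ob] := T8n_card_eq n_gt0 genT.
rewrite -(Lagrange (subsetT N)) (T8n_indexE genT) ob -orderE oa.
by rewrite mulnAC.
Qed.

(** The default value of [nth] is the whole group, so the chain stays increasing at every index. *)
Definition T8n_chain (i : nat) : {group gT} := nth [set: gT]%G [:: 1%G; H; N] i.

(** These are the partial sums of the coefficients -1, n, -2n, 8n of the averaging operators along
    the chain. *)
Definition T8n_eigenvalue (i : nat) : algC :=
  nth 0 [:: -1; n%:R - 1; - n%:R - 1; 7 * n%:R - 1] i.

Lemma T8n_adjacencyE
    (e := fun i => if (i < 4)%N then avg_mx (T8n_chain i) else 0) :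
  adjacency_mx (cayley (T8n_S a b)) =
  \sum_(i < 4) T8n_eigenvalue i *: (e i - e i.+1).
Proof.
have oN : #|N| = (2 * n)%N by have [oa _] := T8n_card_eq n_gt0 genT.
(* The indicator of S is that of G minus N plus H minus 1; summation by parts then gives the
   differences. *)
transitivity (adjacency_mx (cayley [set: gT]) - adjacency_mx (cayley N)
   + adjacency_mx (cayley H) - adjacency_mx (cayley (1%g : {set gT}))).
  apply/matrixP => i j; rewrite !mxE /cayley; set x := (_ * _^-1)%g.
  rewrite (mem_T8n_S n_gt0 genT) in_setT in_setD1 inE.
  have := subsetP T8n_sub_H_N x; have [->|_] := eqVneq x 1%g.
    by rewrite !group1 ?eqxx subrr add0r subrr.
  case: (x \in <[_]>%g) => [->|_] //=; first by rewrite subrr add0r subr0.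
  by case: (x \in _) => /=; rewrite ?subr0 ?subrr ?addr0.
rewrite !avg_mxE ?T8n_card_H ?T8n_card_G ?oN ?cards1.
rewrite !big_ord_recl big_ord0 /e /T8n_chain /T8n_eigenvalue /= subr0 addr0.
by apply/matrixP => i j; rewrite !mxE !natrM; ring.
Qed.

Lemma T8n_char_poly :
  char_poly (adjacency_mx (cayley (T8n_S a b))) =
  \prod_(z <- nseq 1 (7 * n%:R - 1) ++ nseq 3 (- n%:R - 1) ++
         nseq 4 (n%:R - 1) ++ nseq (8 * (n - 1)) (-1)) ('X - z%:P).
Proof.
have [oa ob] := T8n_card_eq n_gt0 genT.
have iN : #|[set: gT] : N|%g = 4%N by rewrite (T8n_indexE genT) ob.
have iH : #|[set: gT] : H|%g = 8%N.
  by rewrite -divgS ?subsetT // T8n_card_H T8n_card_G mulnK.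
have i1 : #|[set: gT] : 1|%g = (8 * n)%N by rewrite indexg1 T8n_card_G.
rewrite T8n_adjacencyE char_poly_subgroup_chain //; last first.
  case=> [|[|[|i]]]; rewrite /T8n_chain /=.
  - exact: sub1G.
  - exact: T8n_sub_H_N.
  - exact: subsetT.
  by rewrite !nth_nil.
rewrite !big_cat !big_nseq !iter_mulr_1 !big_ord_recl big_ord0.
(* The indices 8n, 8, 4, 1, followed by 0, have the differences 8n - 8, 4, 3, 1. *)
rewrite /T8n_chain /T8n_eigenvalue /= i1 iH iN indexgg.
rewrite !subSS !subn0 mulr1 mulnBr muln1.
by rewrite mulrC (mulrC (_ ^+ 4)) (mulrC (_ ^+ 3)) -!mulrA.
Qed.
End Spectrum.

Theorem corollary3p2 (n : nat) (gT : finGroupType) (a b : gT) :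
  (0 < n)%N -> T8n_gens n a b ->
  [/\ connection_set (T8n_S a b),
      connected_graph (cayley (T8n_S a b)),
      integral_graph (cayley (T8n_S a b))
    & perm_eq (Spec (adjacency_mx (cayley (T8n_S a b))))
        (nseq 1 (7 * n%:R - 1) ++ nseq 3 (- n%:R - 1) ++
         nseq 4 (n%:R - 1) ++ nseq (8 * (n - 1)) (-1))].
Proof.
move=> n_gt0 genT; have memS := mem_T8n_S n_gt0 genT.
have bN := T8n_notin_b n_gt0 genT; have chiE := T8n_char_poly n_gt0 genT.
split; last exact: Spec_eq.
- split; first by apply/set0Pn; exists b; rewrite memS bN.
    by rewrite memS group1 setD11.
  by apply/setP => x; rewrite inE !memS !in_setD1 !groupV invg_eq1.
- move=> x y; case xyN: ((x * y^-1)%g \in <[a]>%g); last first.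
    by apply: connect1; rewrite /cayley memS xyN.
  (* Two vertices in the same coset of <a> are joined by a path through b x. *)
  apply: (connect_trans (y := (b * x)%g)); apply: connect1;
    rewrite /cayley memS.
    by rewrite invMg mulKVg groupV bN.
  by rewrite -mulgA groupMr ?bN.
move=> z; rewrite eigenvalue_root_char chiE root_prod_XsubC !mem_cat.
have intn : n%:R \is a @Num.int algC by exact: natr_int.
case/or4P; move/nseqP => -[-> _];
  by rewrite ?(rpredB, rpredN, rpredM, rpred1, natr_int).
Qed.
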